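(* Let $k$ be a field, let $R = k[x_1,\ldots,x_n]$, and let $G$ be a forest (a graph without cycles) on the vertex set $\{x_1,\ldots,x_n\}$ with at least one nontrivial edge. Let $I = I(G)\subseteq R$ be its edge ideal and let $\alpha_2(G)$ be its star packing number. Then for all integers $s\geq 1$, $$\operatorname{depth} R/I^s \geq \max\{\alpha_2(G)-s+1,\ 1\}.$$
   Context: Graphs are finite and simple; the vertices of $G$ are identified with the variables of $R$, and a nontrivial edge is an edge with two distinct endpoints. The edge ideal is $I(G)=\langle x_ix_j \mid \{x_i,x_j\}\in E_G\rangle\subseteq R$. For a vertex $x$, $N_G(x)$ is the set of neighbors of $x$ and $N_G[x]=N_G(x)\cup\{x\}$ is the closed neighborhood. For a graph $G$, the star on a vertex $b_0$ is the linear sum of all vertices in $N_G[b_0]$; its support is $N_G[b_0]$ (if $b_0$ is an isolated vertex, the star is just $b_0$). A star packing of $G$ is a collection $S$ of stars whose supports are pairwise disjoint and such that $N_G[x]\cap \operatorname{Supp}(S)\neq\emptyset$ for every $x\in V_G$, where $\operatorname{Supp}(S)$ is the union of the supports of the stars in $S$ (i.e. no further disjoint star can be added). The star packing number is $\alpha_2(G)=\max\{|S| \mid S \text{ is a star packing of } G\}$. Equivalently, $\alpha_2(G)$ is the maximum cardinality of a set of vertices whose closed neighborhoods are pairwise disjoint. Depth is taken with respect to the homogeneous maximal ideal $(x_1,\ldots,x_n)$. *)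

(* Defs.v *)
From mathcomp Require Export all_boot all_order all_algebra.
From mathcomp Require Export mpoly boolp constructive_ereal.

Set Implicit Arguments.
Unset Strict Implicit.
Unset Printing Implicit Defensive.

Import Order.TTheory GRing.Theory Num.Theory.
Local Open Scope ring_scope.

Section Ideals.
Variable R : comNzRingType.
Implicit Types (S J m : R -> Prop) (fs : seq R).

Definition ideal_gen S : R -> Prop := fun f =>
  exists2 r : seq (R * R),
    (forall p, p \in r -> S p.2) & f = \sum_(p <- r) p.1 * p.2.

(* The case s = 0 gives the unit ideal, through the empty product. *)
Definition ideal_pow J (s : nat) : R -> Prop :=
  ideal_gen (fun f => exists2 g : 'I_s -> R,
    (forall i, J (g i)) & f = \prod_(i < s) g i).

Definition ideal_adjoin J fs : R -> Prop :=
  ideal_gen (fun f => J f \/ f \in fs).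

(* fs is a regular sequence on the R-module R/J. Membership in an ideal stands
   for vanishing in the corresponding quotient: each fs`_i is a nonzerodivisor
   on R/(J, fs`_0, ..., fs`_(i-1)), and R/(J, fs) is nonzero. *)
Definition regular_seq J fs : Prop :=
  (forall i, (i < size fs)%N -> forall g : R,
     ideal_adjoin J (take i fs) (fs`_i * g) -> ideal_adjoin J (take i fs) g)
  /\ ~ ideal_adjoin J fs 1.

Definition has_regular_seq m J (d : nat) : Prop :=
  exists fs, [/\ size fs = d, forall f, f \in fs -> m f & regular_seq J fs].

Definition is_max_regular_length m J (d : nat) : Prop :=
  has_regular_seq m J d /\ (forall d', has_regular_seq m J d' -> (d' <= d)%N).

(* depth of R/J with respect to m: the maximal length of a regular sequence on
   R/J with terms in m. It is +oo if there is no such maximum, in particular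
   when R/J = 0. *)
Definition depth_quotient m J : \bar int :=
  if pselect (exists d, is_max_regular_length m J d) is left h
  then ((projT1 (cid h))%:Z)%:E else +oo%E.

End Ideals.

Definition irrelevant_ideal (k : fieldType) (n : nat) : {mpoly k[n]} -> Prop :=
  ideal_gen (fun f => exists i : 'I_n, f = 'X_i).

Definition edge_ideal (k : fieldType) (n : nat) (e : rel 'I_n) :
    {mpoly k[n]} -> Prop :=
  ideal_gen (fun f => exists i j : 'I_n, e i j /\ f = 'X_i * 'X_j).
Arguments irrelevant_ideal k n : clear implicits.
Arguments edge_ideal k {n} e.

Section Graphs.
Variable V : finType.
Implicit Types (e : rel V) (S : {set {set V}}).

Definition simple_graph e : Prop := ssrbool.symmetric e /\ irreflexive e.

(* The bound 2 < size c excludes the closed walk x, y, x along one edge. *)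
Definition forest e : Prop :=
  forall c : seq V, (2 < size c)%N -> uniq c -> ~~ cycle e c.

Definition open_nbhd e (x : V) : {set V} := [set y | e x y].
Definition closed_nbhd e (x : V) : {set V} := x |: open_nbhd e x.

(* A star is the sum of the variables in a closed neighborhood. As such a sum
   is determined by its support, stars are encoded by their supports. In
   particular, two centers with the same closed neighborhood give one star. *)
Definition stars e : {set {set V}} := [set closed_nbhd e b | b in V].

Definition star_packing e S : bool :=
  [&& S \subset stars e, trivIset S
    & [forall x, closed_nbhd e x :&: cover S != set0]].

Definition star_packing_number e : nat :=
  \max_(S : {set {set V}} | star_packing e S) #|S|.

End Graphs.

(* Main.v *)
(* Write P_K for the ideal of the variables in K and I for the edge ideal. The
   ideals J = P_K + I^s are monomial, and if y is the second vertex of a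
   longest path of G \ K, all but at most one of its neighbors are leaves.
   Repeatedly passing from J to J : u and J + (u), for u first y and then the
   neighbors of y, then only produces ideals of the forms P_K' + I^s and P_K'
   + I^(s-1), with a loss of at most one star in the second form and none in
   the first. One ends with ideals P_K having at least t = max(alpha_2 - s +
   1, 1) variables outside of K. The elementary symmetric polynomials e_1,
   ..., e_t are a regular sequence modulo all these P_K at once, hence modulo
   I^s by the exact sequences 0 -> R/(J : u) -> R/J -> R/(J + u) -> 0. A lower
   bound on the depth, as a maximal length, only asks for one regular
   sequence. *)
Require Import Defs.
From mathcomp Require Import ring zify.
Import Order.TTheory GRing.Theory Num.Theory.
Local Open Scope ring_scope.
Set Implicit Arguments.
Unset Strict Implicit.
Unset Printing Implicit Defensive.

(** * Ideals as predicates, colon ideals and weakly regular sequences *)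

Section WeaklyRegular.
Variable R : comNzRingType.
Implicit Types (J : R -> Prop) (f g u x : R) (fs : seq R).

Definition is_ideal J :=
  [/\ J 0, forall a b, J a -> J b -> J (a + b) & forall r a, J a -> J (r * a)].

(** The ideal $J + (f)$ with one explicit cofactor, in a form that [foldl] can iterate along a
    sequence. *)
Definition adj J f : R -> Prop := fun g => exists h, J (g - f * h).
Definition colon J u : R -> Prop := fun g => J (u * g).
Definition nzd J f := forall g, J (f * g) -> J g.

(** Only weak regularity: the quotient is allowed to vanish, so that sequences pass through exact
    sequences with a zero term. Properness is checked once, at the very end. *)
Fixpoint wreg J fs : Prop :=
  if fs is f :: fs' then nzd J f /\ wreg (adj J f) fs' else True.

Lemma ideal0 J : is_ideal J -> J 0. Proof. by case. Qed.
Lemma idealD J a b : is_ideal J -> J a -> J b -> J (a + b).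
Proof. by case=> _ h _; apply: h. Qed.
Lemma idealMl J r a : is_ideal J -> J a -> J (r * a).
Proof. by case=> _ _; apply. Qed.
Lemma idealB J a b : is_ideal J -> J a -> J b -> J (a - b).
Proof. by move=> iJ Ja Jb; rewrite -mulN1r; apply: idealD => //;
  apply: idealMl. Qed.

Lemma ideal_sum J (T : eqType) (r : seq T) (P : pred T) (F : T -> R) :
  is_ideal J -> (forall i, i \in r -> P i -> J (F i)) -> J (\sum_(i <- r |
    P i) F i).
Proof.
move=> iJ JF; rewrite big_seq_cond; elim/big_rec: _; first exact: ideal0.
by move=> i x /andP[ri Pi] Jx; apply: idealD => //; apply: JF.
Qed.

Lemma ideal_subl J f g : is_ideal J -> J (f - g) -> J g -> J f.
Proof. by move=> iJ Jd Jg; rewrite -(subrK g f); apply: idealD. Qed.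

Lemma is_ideal_adj J f : is_ideal J -> is_ideal (adj J f).
Proof.
move=> iJ; split.
- by exists 0; rewrite mulr0 subrr; apply: ideal0.
- move=> a b [h Ja] [h' Jb]; exists (h + h').
  by rewrite mulrDr opprD addrACA; apply: idealD.
- by move=> r a [h Ja]; exists (r * h); rewrite mulrCA -mulrBr; apply: idealMl.
Qed.

Lemma is_ideal_colon J u : is_ideal J -> is_ideal (colon J u).
Proof.
move=> iJ; rewrite /colon; split=> [|a b Ja Jb|r a Ja].
- by rewrite mulr0; apply: ideal0.
- by rewrite mulrDr; apply: idealD.
- by rewrite mulrCA; apply: idealMl.
Qed.

Lemma adj_sub J f g : is_ideal J -> J g -> adj J f g.
Proof. by move=> iJ Jg; exists 0; rewrite mulr0 subr0. Qed.

Lemma adj_mem J f : is_ideal J -> adj J f f.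
Proof. by move=> iJ; exists 1; rewrite mulr1 subrr; apply: ideal0. Qed.

Lemma adjC J f g : adj (adj J f) g = adj (adj J g) f.
Proof.
by apply/predeqP=> a; split=> -[h [h' ?]]; exists h', h; rewrite addrAC.
Qed.

(** The sequence $0 \to R/(J:u) \to R/J \to R/(J+u) \to 0$ stays exact modulo $f$, because $f$ is a
    nonzerodivisor on the last term. *)
Lemma colon_adj J f u : is_ideal J -> nzd (adj J u) f ->
  colon (adj J f) u = adj (colon J u) f.
Proof.
move=> iJ reg; apply/predeqP=> g; split=> [[h Jh]|[h Jh]]; last first.
  by exists (u * h); rewrite mulrCA -mulrBr.
have [h' Jh'] : adj J u h.
  by apply: reg; exists g; rewrite -[_ - _]opprB -mulN1r; apply: idealMl.
exists h'; rewrite /colon mulrBr [u * (f * _)]mulrCA.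
apply: (ideal_subl (g := u * g - f * h)) => //.
have -> : u * g - f * (u * h') - (u * g - f * h) = f * (h - u * h') by ring.
exact: idealMl.
Qed.

Lemma nzd_extend J u f : is_ideal J -> nzd (colon J u) f -> nzd (adj J u) f ->
  nzd J f.
Proof.
move=> iJ r1 r2 g Jfg; have [h Jh] : adj J u g by apply: r2; apply: adj_sub.
apply: (ideal_subl _ Jh) => //; apply: r1; rewrite /colon mulrCA.
have -> : f * (u * h) = f * g - f * (g - u * h) by ring.
by apply: idealB => //; apply: idealMl.
Qed.

(** Regularity on both ends of $0 \to R/(J:u) \to R/J \to R/(J+u) \to 0$ gives it in the middle.
    After dividing by the first term, [colon_adj] and [adjC] show that the ends are again a colon
    and a sum. *)
Lemma wreg_extend J u fs : is_ideal J ->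
  wreg (colon J u) fs -> wreg (adj J u) fs -> wreg J fs.
Proof.
elim: fs J => [|f fs IH] J iJ //= [r1 w1] [r2 w2].
split; first exact: nzd_extend r1 r2.
by apply: IH; [apply: is_ideal_adj|rewrite colon_adj|rewrite adjC].
Qed.

(** The half of the exchange of a regular pair $x, f$ that holds in any commutative ring; the other
    half needs a grading. *)
Lemma nzd_adj J x f : is_ideal J -> nzd J x -> nzd (adj J x) f ->
  nzd (adj J f) x.
Proof.
move=> iJ rx rf g [h Jh].
have [h' Jh'] : adj J x h.
  by apply: rf; exists g; rewrite -[_ - _]opprB -mulN1r; apply: idealMl.
exists h'; apply: rx.
have -> : x * (g - f * h') = x * g - f * h + f * (h - x * h') by ring.
by apply: idealD => //; apply: idealMl.
Qed.

Lemma nzdM J f g : nzd J f -> nzd J g -> nzd J (f * g).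
Proof. by move=> rf rg h; rewrite -mulrA => /rf/rg. Qed.

Lemma nzd_prod J (T : finType) (A : {set T}) (F : T -> R) :
  (forall i, i \in A -> nzd J (F i)) -> nzd J (\prod_(i in A) F i).
Proof.
move=> rF; elim/big_rec: _ => [g|i x iA rx]; first by rewrite mul1r.
by apply: nzdM => //; apply: rF.
Qed.

Lemma nzd_congr J f g : is_ideal J -> J (f - g) -> nzd J g -> nzd J f.
Proof.
move=> iJ Jd rg h Jh; apply: rg.
have -> : g * h = f * h - h * (f - g) by ring.
by apply: idealB => //; apply: idealMl.
Qed.

Lemma wreg_rcons J fs f :
  wreg J fs -> nzd (foldl adj J fs) f -> wreg J (rcons fs f).
Proof. by elim: fs J => [|g fs IH] J //= [rg w] rf; split=> //; apply: IH. Qed.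

Lemma is_ideal_foldl_adj J fs : is_ideal J -> is_ideal (foldl adj J fs).
Proof. by elim: fs J => //= f fs IH J iJ; apply: IH; apply: is_ideal_adj. Qed.

Lemma foldl_adj_sub J fs g : is_ideal J -> J g -> foldl adj J fs g.
Proof.
elim: fs J => //= f fs IH J iJ Jg.
by apply: IH; [apply: is_ideal_adj|apply: adj_sub].
Qed.

Lemma foldl_adj_mem J fs f : is_ideal J -> f \in fs -> foldl adj J fs f.
Proof.
elim: fs J => //= g fs IH J iJ; rewrite inE => /orP[/eqP->|]; last first.
  by apply: IH => //; apply: is_ideal_adj.
by apply: foldl_adj_sub; [apply: is_ideal_adj|apply: adj_mem].
Qed.

Lemma foldl_adj_min J L fs g : is_ideal L -> (forall a, J a -> L a) ->
  (forall f, f \in fs -> L f) -> foldl adj J fs g -> L g.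
Proof.
move=> iL; elim: fs J => [|f fs IH] J JL fL; first exact: JL.
apply: IH => [a [h /JL La]|f' f'fs]; last by apply: fL; rewrite inE f'fs orbT.
by apply: ideal_subl La _ => //; rewrite mulrC; apply: idealMl => //;
  apply/fL/mem_head.
Qed.

Lemma nzd_foldl_adj J x fs : is_ideal J -> nzd J x -> wreg (adj J x) fs ->
  nzd (foldl adj J fs) x.
Proof.
elim: fs J => //= f fs IH J iJ rx [rf w]; apply: IH; first exact: is_ideal_adj.
  exact: nzd_adj.
by rewrite adjC.
Qed.

Lemma is_ideal_gen (S : R -> Prop) : is_ideal (ideal_gen S).
Proof.
split.
- by exists [::]; rewrite ?big_nil.
- move=> a b [r Sr ->] [r' Sr' ->]; exists (r ++ r'); last by rewrite big_cat.
  by move=> p; rewrite mem_cat => /orP[/Sr|/Sr'].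
- move=> c a [r Sr ->]; exists [seq (c * p.1, p.2) | p <- r].
    by move=> p /mapP[q /Sr ? ->].
  by rewrite big_map mulr_sumr; apply: eq_bigr => p _; rewrite mulrA.
Qed.

Lemma mem_ideal_gen (S : R -> Prop) f : S f -> ideal_gen S f.
Proof.
move=> Sf; exists [:: (1, f)]; last by rewrite big_seq1 mul1r.
by move=> p; rewrite inE => /eqP->.
Qed.

Lemma ideal_gen_min (S J : R -> Prop) f : is_ideal J ->
  (forall g, S g -> J g) -> ideal_gen S f -> J f.
Proof.
by move=> iJ SJ [r Sr ->]; apply: ideal_sum => // p pr _;
  apply: idealMl => //; apply/SJ/Sr.
Qed.

Lemma ideal_adjoinE J fs : is_ideal J -> ideal_adjoin J fs = foldl adj J fs.
Proof.
move=> iJ; apply/predeqP=> g; split.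
  apply: ideal_gen_min; first exact: is_ideal_foldl_adj.
  by move=> f [Jf|fs_f]; [apply: foldl_adj_sub|apply: foldl_adj_mem].
apply: foldl_adj_min; first exact: is_ideal_gen.
  by move=> a Ja; apply: mem_ideal_gen; left.
by move=> f fs_f; apply: mem_ideal_gen; right.
Qed.

Lemma wreg_nzd J fs i : wreg J fs -> (i < size fs)%N ->
  nzd (foldl adj J (take i fs)) fs`_i.
Proof.
by elim: fs J i => // f fs IH J [|i] /= [rf w]; rewrite // ltnS; apply: IH.
Qed.

Lemma wreg_full J fs : (forall f, J f) -> wreg J fs.
Proof.
elim: fs J => //= f fs IH J JT; split=> //; apply: IH => g.
by exists 0; apply: JT.
Qed.

End WeaklyRegular.

(** * Exchanging terms of a regular sequence in the graded case *)

Section Graded.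
Variables (n : nat) (k : fieldType).
Implicit Types (f g h x : {mpoly k[n]}) (J : {mpoly k[n]} -> Prop) (fs :
  seq {mpoly k[n]}).

Definition graded_ideal J := forall d g, J g -> J (pihomog mdeg d g).

Lemma pihomogM c d f h : f \is c.-homog ->
  pihomog mdeg (c + d) (f * h) = f * pihomog mdeg d h.
Proof.
move=> fa; rewrite [in LHS](mpolyE h) mulr_sumr raddf_sum pihomogE mulr_sumr.
rewrite [RHS]big_mkcond; apply: eq_bigr => m _ /=.
rewrite -scalerAr linearZ /=.
have hom : f * 'X_[m] \is (c + mdeg m)%N.-homog.
  by apply: dhomogM => //; rewrite dhomogX.
case: eqVneq => [<-|ne]; first by rewrite pihomog_dE.
by rewrite (pihomog_ne0 _ hom) ?eqn_add2l // scaler0.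
Qed.

Lemma pihomogM_lt c d f h : f \is c.-homog -> (d < c)%N ->
  pihomog mdeg d (f * h) = 0.
Proof.
move=> fa lt_da; rewrite (mpolyE h) mulr_sumr raddf_sum big1 // => m _ /=.
rewrite -scalerAr linearZ /=.
have hom : f * 'X_[m] \is (c + mdeg m)%N.-homog.
  by apply: dhomogM => //; rewrite dhomogX.
rewrite (pihomog_ne0 _ hom) ?scaler0 // gtn_eqF //.
exact: leq_trans (leq_addr _ _).
Qed.

Lemma graded_ideal_adj c J f : graded_ideal J -> f \is c.-homog ->
  graded_ideal (adj J f).
Proof.
move=> gJ fa d g [h Jh]; have := gJ d _ Jh; rewrite pihomogB.
case: (ssrnat.leqP c d) => [/subnKC <-|lt_da].
  by rewrite pihomogM // => ?; exists (pihomog mdeg (d - c) h).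
by rewrite (pihomogM_lt _ fa) // => ?; exists 0; rewrite mulr0.
Qed.

(* By induction on the degree of g: if f g lies in J then g = j + x h with j in
   J, and f h lies in J as well. *)
Lemma graded_nzd_lift c J f x : is_ideal J -> graded_ideal J ->
  f \is c.-homog -> x \is 1.-homog ->
  nzd J x -> nzd (adj J x) f -> nzd J f.
Proof.
move=> iJ gJ fa x1 rx rf.
(* As $J$ is graded, the homogeneous components of $g$ can be treated one at a time. *)
suff hom_case d g : g \is d.-homog -> J (f * g) -> J g.
  move=> g Jfg; rewrite (pihomog_partitionE (leqnn (mmeasure mdeg g))).
  apply: ideal_sum => // d _ _; apply: (hom_case d); first exact: pihomogP.
  by rewrite -(pihomogM d g fa); apply: gJ.
elim: d g => [|d IH] g gd Jfg.
  have [h /(gJ 0%N)] : adj J x g by apply: rf; apply: adj_sub.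
  by rewrite pihomogB (pihomogM_lt h x1) // subr0 pihomog_dE.
have [h /(gJ (1 + d)%N)] : adj J x g by apply: rf; apply: adj_sub.
rewrite pihomogB pihomogM // pihomog_dE //; set h' := pihomog _ _ _ => Jd.
apply: (ideal_subl _ Jd) => //; apply: idealMl => //.
apply: IH; first exact: pihomogP.
apply: rx; have -> : x * (f * h') = f * g - f * (g - x * h') by ring.
by apply: idealB => //; apply: idealMl.
Qed.

Lemma graded_wreg_lift J x fs : is_ideal J -> graded_ideal J ->
  (forall f, f \in fs -> exists c, f \is c.-homog) -> x \is 1.-homog ->
  nzd J x -> wreg (adj J x) fs -> wreg J fs.
Proof.
elim: fs J => //= f fs IH J iJ gJ fs_hom x1 rx [rf w].
have [c fa] := fs_hom f (mem_head _ _).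
split; first exact: (graded_nzd_lift iJ gJ fa x1).
apply: IH => //; first exact: is_ideal_adj.
- exact: graded_ideal_adj gJ fa.
- by move=> g gfs; apply: fs_hom; rewrite inE gfs orbT.
- exact: nzd_adj.
- by rewrite adjC.
Qed.

End Graded.

(** * Monomial ideals, and symmetric polynomials modulo variables *)

Section MonomialIdeals.
Variables (n : nat) (k : fieldType).
Implicit Types (f g : {mpoly k[n]}) (m : 'X_{1..n}) (Q : 'X_{1..n} -> Prop).
Implicit Types (K : {set 'I_n}).

(** Membership is read off the support, so an equality of monomial ideals reduces to an equivalence
    of predicates on exponents. It is an ideal once [Q] is an [upset]. *)
Definition mon_ideal Q f := forall m, f@_m != 0 -> Q m.
Definition upset Q := forall m m', Q m -> Q (m' + m)%MM.

Lemma is_ideal_mon Q : upset Q -> is_ideal (mon_ideal Q).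
Proof.
move=> uQ; split.
- by move=> m; rewrite mcoeff0 eqxx.
- move=> a b Qa Qb m; rewrite mcoeffD; have [a0|/Qa//] := eqVneq a@_m 0.
  by rewrite a0 add0r => /Qb.
- move=> r a Qa m; rewrite -mcoeff_msupp => /msuppM_le/allpairsP[[m1 m2] /=].
  by case=> _ am2 ->; apply: uQ; apply: Qa; rewrite -mcoeff_msupp.
Qed.

Lemma mon_ideal_min Q (J : {mpoly k[n]} -> Prop) f : is_ideal J ->
  (forall m, Q m -> J 'X_[m]) -> mon_ideal Q f -> J f.
Proof.
move=> iJ QJ Qf; rewrite (mpolyE f); apply: ideal_sum => // m mf _.
rewrite -mul_mpolyC; apply: idealMl => //; apply: QJ.
by apply: Qf; rewrite -mcoeff_msupp.
Qed.

Lemma mon_idealX Q m : mon_ideal Q 'X_[m] <-> Q m.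
Proof.
split=> [|Qm m']; first by apply; rewrite mcoeffX eqxx oner_eq0.
by rewrite mcoeffX; case: (eqVneq m m') => [<-|]; rewrite ?eqxx.
Qed.

Lemma colon_mon Q i :
  colon (mon_ideal Q) 'X_i = mon_ideal (fun m => Q (m + U_(i))%MM).
Proof.
apply/predeqP=> f; rewrite /colon mulrC; split=> Qf m.
  by move=> fm; apply: Qf; rewrite addmC mcoeffMX.
rewrite -mcoeff_msupp (perm_mem (msuppMX _ _)) => /mapP[m' m'f ->].
by rewrite addmC; apply: Qf; rewrite -mcoeff_msupp.
Qed.

Lemma mcoeffXM_eq0 i f m : m i = 0%N -> ('X_i * f)@_m = 0.
Proof.
move=> mi0; apply/eqP; rewrite mcoeff_eq0 mulrC (perm_mem (msuppMX _ _)).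
by apply/mapP=> -[m' _ mE]; move: mi0; rewrite mE mnmDE mnm1E eqxx.
Qed.

Lemma mnm_subK i m : (0 < m i)%N -> (m - U_(i) + U_(i))%MM = m.
Proof.
move=> mi; apply: submK; apply/mnm_lepP => j; rewrite mnm1E.
by case: eqVneq => [<-|].
Qed.

Lemma adj_mon Q i : upset Q ->
  adj (mon_ideal Q) 'X_i = mon_ideal (fun m => Q m \/ (0 < m i)%N).
Proof.
move=> uQ; have iQ := is_ideal_mon uQ; apply/predeqP=> f; split.
  move=> [h Qh] m fm; rewrite lt0n; have [mi0|] := eqVneq (m i) 0%N;
    last by right.
  by left; apply: Qh; rewrite mcoeffB mcoeffXM_eq0 // subr0.
apply: mon_ideal_min; first exact: is_ideal_adj.
move=> m [Qm|mi]; first by apply: adj_sub => //; apply/mon_idealX.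
rewrite -(mnm_subK mi) mpolyXD; apply: idealMl; first exact: is_ideal_adj.
exact: adj_mem.
Qed.

Lemma graded_mon Q : graded_ideal (mon_ideal Q).
Proof.
move=> d g Qg m; rewrite -mcoeff_msupp => md.
have := dhomog_mf (pihomogP mdeg d g) md => /= dE.
suff gE : (pihomog mdeg d g)@_m = g@_m by apply: Qg; rewrite -gE -mcoeff_msupp.
rewrite pihomogE [X in _ = X@__](mpolyE g) !raddf_sum /= big_mkcond /=.
apply: eq_bigr => m' _; case: (eqVneq (mdeg m') d) => // ne.
rewrite mcoeffZ mcoeffX; case: (eqVneq m' m) => [mE|]; rewrite ?mulr0 //.
by rewrite mE dE eqxx in ne.
Qed.

(** The exponents of the monomials in $P_K$. *)
Definition meets K m := exists2 i, i \in K & (0 < m i)%N.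

Lemma upset_meets K : upset (meets K).
Proof.
by move=> m m' [i iK mi]; exists i => //;
  rewrite mnmDE (leq_trans mi) ?leq_addl.
Qed.

Lemma is_ideal_vars K : is_ideal (mon_ideal (meets K)).
Proof. exact/is_ideal_mon/upset_meets. Qed.

Lemma meetsU1 K i m : meets (i |: K) m <-> meets K m \/ (0 < m i)%N.
Proof.
split=> [[j]|[[j jK mj]|mi]].
- by rewrite !inE => /orP[/eqP->|jK]; [right|left; exists j].
- by exists j => //; rewrite !inE jK orbT.
- by exists i => //; rewrite !inE eqxx.
Qed.

Lemma meetsD K i m : i \notin K -> meets K (m + U_(i))%MM <-> meets K m.
Proof.
move=> iK; split=> -[j jK]; rewrite ?mnmDE ?mnm1E => mj; exists j => //.
  by move: mj; case: eqVneq => [ij|_]; rewrite ?addn0 // ij jK in iK *.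
by rewrite mnmDE (leq_trans mj) ?leq_addr.
Qed.

Lemma adj_vars K i :
  adj (mon_ideal (meets K)) 'X_i = mon_ideal (meets (i |: K)).
Proof.
rewrite adj_mon; last exact: upset_meets.
by congr mon_ideal; apply/predeqP=> m; rewrite meetsU1.
Qed.

Lemma nzd_vars K i : i \notin K -> nzd (mon_ideal (meets K)) 'X_i.
Proof.
move=> iK f; rewrite -/(colon _ _ _) colon_mon.
by move=> Kf m /Kf /(meetsD _ iK).
Qed.

Definition esyms t := [seq mesym n k i.+1 | i <- iota 0 t].

Lemma esymsS t : esyms t.+1 = rcons (esyms t) (mesym n k t.+1).
Proof. by rewrite /esyms -[X in iota _ X]addn1 iotaD map_cat cats1. Qed.

Lemma esyms_homog t f : f \in esyms t -> exists c, f \is c.-homog.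
Proof. by case/mapP=> i _ ->; exists i.+1; apply: dhomog_mesym. Qed.

(** A squarefree monomial of degree [#|~: K|] other than the product over [~: K] contains a variable
    of [K]. *)
Lemma mesym_top_mod_vars K :
  mon_ideal (meets K) (mesym n k #|~: K| - \prod_(i in ~: K) 'X_i).
Proof.
rewrite /mesym (bigD1 (~: K)) //= addrC addrK.
apply: (ideal_sum (is_ideal_vars K)) => h _ /andP[/eqP hK hneq].
have /subsetPn[i ih] : ~~ (h \subset ~: K).
  by apply: contra hneq => sub; rewrite eqEcard sub hK leqnn.
rewrite inE negbK => iK; rewrite (bigD1 i) //= mulrC.
apply: (idealMl _ (is_ideal_vars K)).
by apply/mon_idealX; exists i => //; rewrite mnm1E eqxx.
Qed.

(** Outer induction on $t$, inner induction on the number $r$ of surplus variables outside [K]. A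
    surplus variable is killed and then lifted back by [graded_wreg_lift]. *)
Lemma wreg_esyms_vars K t : (t <= #|~: K|)%N ->
  wreg (mon_ideal (meets K)) (esyms t).
Proof.
elim: t K => [|t IHt] K // tK.
have X1 i : ('X_i : {mpoly k[n]}) \is 1.-homog by rewrite dhomogX /= mdeg1.
have cardU (L : {set 'I_n}) i : i \notin L -> #|~: L| = #|~: (i |: L)|.+1.
  move=> iL; rewrite (cardsD1 i) inE iL add1n; congr _.+1; apply: eq_card => j.
  by rewrite !inE negb_or.
move: {2}(#|~: K| - t.+1)%N (erefl (#|~: K| - t.+1)%N) => r.
elim: r K tK => [|r IHr] K tK rE.
  have tE : t.+1 = #|~: K| by apply/eqP; rewrite eqn_leq tK -subn_eq0 rE.
  (* Without surplus, the last symmetric polynomial is the product of the remaining variables modulo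
     $P_K$. Each factor is regular modulo the earlier ones, since these are regular modulo $P_K$ and
     that variable by induction on $t$. *)
  rewrite esymsS; apply: wreg_rcons; first by apply: IHt; apply: ltnW.
  apply: (nzd_congr (g := \prod_(i in ~: K) 'X_i)).
  - exact/is_ideal_foldl_adj/is_ideal_vars.
  - apply: foldl_adj_sub; first exact: is_ideal_vars.
    by rewrite tE; apply: mesym_top_mod_vars.
  apply: nzd_prod => i; rewrite inE => iK.
  apply: nzd_foldl_adj; [exact: is_ideal_vars|exact: nzd_vars|].
  by rewrite adj_vars; apply: IHt; move: tE; rewrite (cardU K i iK) => -[->].
have /card_gt0P[i] : (0 < #|~: K|)%N by apply: leq_trans tK.
rewrite inE => iK; apply: (@graded_wreg_lift _ _ _ 'X_i) => //.
- exact: is_ideal_vars.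
- exact: graded_mon.
- exact: esyms_homog.
- exact: nzd_vars.
rewrite adj_vars; move: rE tK; rewrite (cardU K i iK) => rE tK.
by apply: IHr; move: rE tK; move: #|~: (i |: K)| => c; lia.
Qed.

End MonomialIdeals.

(** * The end of a longest path in a forest *)

Section EndVertex.
Variable V : finType.

(* x and y are the first two vertices of a longest path. *)
Lemma forest_end (e : rel V) a b : ssrbool.symmetric e -> irreflexive e ->
  forest e -> e a b ->
  exists x y z, [/\ e y x, e y z, forall w, e x w -> w = y &
    forall w, e y w -> w != z -> forall v, e w v -> v = y].
Proof.
move=> se ie fe eab.
have neq c d : e c d -> c != d by apply: contraTneq => ->; rewrite ie.
pose P l := [exists p : l.-tuple V, if tval p is x ::
  p' then path e x p' && uniq p else false].
have exP : exists l, P l.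
  exists 2; apply/existsP; exists [tuple a; b].
  by rewrite /= eab inE neq.
have leP l : P l -> (l <= #|V|)%N.
  case/existsP=> -[[|x p'] /= /eqP<-] // /and3P[_ xp up].
  have /card_uniqP uE : uniq (x :: p') by rewrite /= xp.
  by move: (max_card (mem (x :: p'))); rewrite uE.
case: (ex_maxnP exP leP) => l /existsP[[p /= /eqP pl]] Pp lmax.
have maxP x q : path e x q -> uniq (x :: q) -> (size (x :: q) <= size p)%N.
  move=> pq uq; rewrite pl; apply: lmax; apply/existsP.
  by exists (Tuple (eqxx (size (x :: q)))); rewrite /= pq.
have : (2 <= size p)%N.
  by apply: (maxP a [:: b]); rewrite /= ?eab // inE neq.
case: p pl Pp maxP {lmax leP exP} =>
  [|x [|y q]] //= pl /and3P[/andP[exy pq] xq].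
move=> /andP[yq uq] maxP _.
(* A further edge from the head of a path back to the path would close a cycle. *)
have chord c d p : path e c (d :: p) -> uniq [:: c, d & p] ->
    forall w, e c w -> w \in [:: c, d & p] -> w = d.
  move=> pp up w ecw; rewrite !inE => /or3P[/eqP wc|/eqP//|wp].
    by rewrite wc ie in ecw.
  case/splitPr: wp pp up => p1 p2 /=; rewrite cat_path /=.
  case/and4P=> ecd pp1 elw _ up; rewrite se in ecw;
    have := fe (c :: d :: rcons p1 w).
  rewrite /= size_rcons => /(_ isT).
  rewrite rcons_path last_rcons ecw andbT ecd rcons_path pp1 elw /= => H.
  have : uniq ([:: c, d & rcons p1 w] ++ p2) by rewrite /= cat_rcons.
  by rewrite cat_uniq => /andP[/H].
(* Such an $x'$ can replace $x$ as the start of a longest path: a neighbor off the path would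
   lengthen it, one on the path is excluded by [chord]. *)
have leaf x' : e x' y -> x' \notin y :: q -> forall w, e x' w -> w = y.
  move=> ex'y x'q w ew; apply: (chord x' y q) => //=.
  - by rewrite ex'y.
  - by rewrite x'q yq.
  apply: contraT => wn; have := maxP w [:: x', y & q].
  rewrite /= se ew ex'y pq -/(_ \in _) wn x'q yq uq /=.
  by move/(_ isT isT); rewrite ltnn.
case: q pq xq yq uq maxP leaf {pl} => [|z q] pq xq yq uq maxP leaf.
  (* The path ends at $y$: every neighbor of $y$ is a leaf, and $x$ itself can serve as $z$. *)
  exists x, y, x; split=> //; first by rewrite se.
  - by rewrite se.
  - exact: leaf.
  move=> w eyw _; apply: leaf; first by rewrite se.
  by rewrite inE eq_sym neq.
exists x, y, z; split=> //; first by rewrite se.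
- by case/andP: pq.
- exact: leaf.
move=> w eyw wz; apply: leaf; first by rewrite se.
rewrite inE negb_or; apply/andP; split.
  by rewrite eq_sym neq.
apply: contra wz => wq; apply/eqP; apply: (chord y z q) => //.
  by rewrite cons_uniq yq uq.
by rewrite inE wq orbT.
Qed.

End EndVertex.

(** * Monomials divisible by a product of edges *)

Local Ltac mnm_lia H :=
  let i := fresh "i" in
  apply/mnmP=> i; move/mnmP/(_ i): H; rewrite !mnmDE; lia.

Section EdgeIdealPowers.
Variables (n : nat) (k : fieldType) (e : rel 'I_n).
Hypothesis e_sym : ssrbool.symmetric e.
Hypothesis e_irr : irreflexive e.
Implicit Types (m : 'X_{1..n}) (K C : {set 'I_n}).

(** The exponents of the monomials in $I^s$; edges may repeat, and what remains at [s = 0] is an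
    arbitrary cofactor. *)
Fixpoint edge_div s m : Prop :=
  if s is s'.+1 then
    exists a b m', [/\ e a b, m = (U_(a) + U_(b) + m')%MM & edge_div s' m']
  else True.

Lemma upset_edge_div s : upset (edge_div s).
Proof.
elim: s => [|s IH] //= m m' [a [b [m1 [eab -> d1]]]].
by exists a, b, (m' + m1)%MM; split=> //;
  [rewrite addmA [(m' + _)%MM]addmC -addmA|apply: IH].
Qed.

Lemma edge_div_case x s m : edge_div s.+1 m ->
  (exists b m', [/\ e x b, m = (U_(x) + U_(b) + m')%MM & edge_div s m']) \/
  (exists a b m', [/\ e a b, a != x, b != x, m =
    (U_(a) + U_(b) + m')%MM & edge_div s m']).
Proof.
move=> /= [a [b [m' [eab mE d]]]].
have [ax|ax] := eqVneq a x; first by left; exists b, m'; rewrite -ax.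
have [bx|bx] := eqVneq b x; last by right; exists a, b, m'.
by left; exists a, m'; rewrite -bx e_sym [(U_(b) + _)%MM]addmC.
Qed.

Lemma mnm_cancel x m p m' : (m + U_(x) = p + m')%MM -> p x = 0%N ->
  exists2 m'', (m' = m'' + U_(x))%MM & (m = p + m'')%MM.
Proof.
move=> /mnmP mE px; exists (m' - U_(x))%MM.
  by rewrite mnm_subK //; have := mE x; rewrite !mnmDE mnm1E eqxx px; lia.
apply/mnmP=> i; rewrite mnmDE mnmBE mnm1E.
have := mE i; rewrite !mnmDE mnm1E; case: eqVneq => [<-|_]; rewrite ?px; lia.
Qed.

Lemma not_meetsD K m m' : ~ meets K (m + m')%MM -> ~ meets K m /\ ~ meets K m'.
Proof.
move=> nK; split=> Km; apply: nK; last exact: upset_meets.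
by rewrite addmC; apply: upset_meets.
Qed.

Lemma not_meets1 K i : ~ meets K U_(i)%MM -> i \notin K.
Proof. by move=> nK; apply/negP=> iK; apply: nK; exists i;
  rewrite ?mnm1E ?eqxx. Qed.

Lemma not_meets_edge K a b m : ~ meets K (U_(a) + U_(b) + m)%MM ->
  [/\ a \notin K, b \notin K & ~ meets K m].
Proof.
case/not_meetsD=> /not_meetsD[/not_meets1 aK /not_meets1 bK] mK.
by split.
Qed.

Lemma edge_mnm0 (a b x : 'I_n) : a != x -> b != x -> (U_(a) + U_(b))%MM x = 0%N.
Proof. by move=> /negPf ax /negPf bx; rewrite mnmDE !mnm1E ax bx. Qed.

Lemma edge_div_edge s a b m m' : e a b -> m = (U_(a) + U_(b) + m')%MM ->
  edge_div s m' ->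
  edge_div s.+1 m.
Proof. by move=> eab mE d; exists a, b, m'. Qed.

(** No edge used in the product contains $y$, because the monomial avoids [K] and all neighbors of
    $y$ lie in [K]. *)
Lemma edge_div_isolated K y s m : y \notin K ->
  (forall w, w \notin K -> ~~ e y w) -> ~ meets K m ->
  edge_div s (m + U_(y))%MM -> edge_div s m.
Proof.
move=> yK iso; elim: s m => // s IH m mK /(edge_div_case y).
have {mK} : ~ meets K (m + U_(y))%MM by rewrite meetsD.
move=> mK [[b [m' [eyb mE _]]]|[a [b [m' [eab ay yb mE d]]]]].
  by move: mK; rewrite mE => /not_meets_edge[_ /iso]; rewrite eyb.
have [m'' m'E {}mE] := mnm_cancel mE (edge_mnm0 ay yb).
rewrite mE; apply: (edge_div_edge eab erefl); apply: IH; last by rewrite -m'E.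
by move: mK; rewrite mE => /not_meetsD[/not_meets_edge[]].
Qed.

Section Leaf.
Variables (K : {set 'I_n}) (x y : 'I_n).
Hypothesis xK : x \notin K.
Hypothesis leaf : forall w, w \notin K -> e x w -> w = y.

(** The only edge that can use the leaf $x$ is $xy$, and it can be traded for $yb$. Edges avoiding
    $x$ are split off by induction. *)
Lemma edge_div_swap b s m : e y b -> ~ meets K m ->
  edge_div s (m + U_(x))%MM -> edge_div s (m + U_(b))%MM.
Proof.
move=> eyb; elim: s m => // s IH m mK /(edge_div_case x).
have {mK} : ~ meets K (m + U_(x))%MM by rewrite meetsD.
move=> mK [[c [m' [exc mE d]]]|[a [c [m' [eac ax cx mE d]]]]].
  have cy : c = y by apply: leaf => //; move: mK;
    rewrite mE => /not_meets_edge[].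
  by apply: (edge_div_edge eyb _ d); rewrite cy in mE; mnm_lia mE.
have [m'' m'E {}mE] := mnm_cancel mE (edge_mnm0 ax cx).
rewrite mE -addmA; apply: (edge_div_edge eac erefl); apply: IH;
  last by rewrite -m'E.
by move: mK; rewrite mE => /not_meetsD[/not_meets_edge[]].
Qed.

(** Split off one edge. If it is $xy$, the cofactor is $m$. If it is $yc$ with $c \neq x$, then $c$
    divides $m$ and [edge_div_swap] trades the $x$ left in the cofactor for $c$. If it avoids both,
    it divides $m$ and induction applies. *)
Lemma edge_div_leaf s m : y \notin K -> ~ meets K m ->
  edge_div s.+1 (m + U_(x) + U_(y))%MM -> edge_div s m.
Proof.
move=> yK; elim: s m => // s IH m mK /(edge_div_case x).
have mxyK : ~ meets K (m + U_(x) + U_(y))%MM by rewrite !meetsD.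
case=> [[b [m' [exb mE d]]]|[a [b [m' [eab ax bx mE d]]]]].
  have yb : b = y.
    by apply: leaf => //; move: mxyK; rewrite mE => /not_meets_edge[].
  by suff -> : m = m' by []; rewrite yb in mE; mnm_lia mE.
have via_y c : e y c -> c != x ->
    (m + U_(x) + U_(y) = U_(y) + U_(c) + m')%MM -> edge_div s.+1 m.
  move=> eyc cx yE; have mxE : (m + U_(x) = U_(c) + m')%MM.
    by apply: (@addIm _ U_(y)%MM); rewrite yE -addmA addmC.
  have cx0 : U_(c)%MM x = 0%N by rewrite mnm1E (negPf cx).
  have [m1 m1E mcE] := mnm_cancel mxE cx0.
  rewrite mcE addmC; apply: edge_div_swap => //; last by rewrite -m1E.
  by move: mK; rewrite mcE => /not_meetsD[].
have [ay|ay] := eqVneq a y; first by rewrite ay in eab mE; apply: (via_y b).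
have [by_|by_] := eqVneq b y.
  apply: (via_y a) => //; first by rewrite e_sym -by_.
  by rewrite mE by_ [(U_(a) + _)%MM]addmC.
have [m1 m1E mxE] := mnm_cancel mE (edge_mnm0 ay by_).
have [m2 m2E mE'] := mnm_cancel mxE (edge_mnm0 ax bx).
rewrite mE'; apply: (edge_div_edge eab erefl); apply: IH;
  last by rewrite -m2E -m1E.
by move: mK; rewrite mE' => /not_meets_edge[].
Qed.

End Leaf.
End EdgeIdealPowers.

(** * Colon ideals of $P_K + I^s$ and star packings outside $K$ *)

Section Depth.
Variables (n : nat) (k : fieldType) (e : rel 'I_n).
Hypothesis e_sym : ssrbool.symmetric e.
Hypothesis e_irr : irreflexive e.
Implicit Types (m : 'X_{1..n}) (K C : {set 'I_n}).

(* The monomials of P_K + I^s. *)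
Definition vars_pow K s m := meets K m \/ edge_div e s m.

Lemma upset_vars_pow K s : upset (vars_pow K s).
Proof.
by move=> m m' [/upset_meets|/upset_edge_div] h; [left|right].
Qed.

Lemma upset_shift (Q : 'X_{1..n} -> Prop) y :
  upset Q -> upset (fun m => Q (m + U_(y))%MM).
Proof. by move=> uQ m m' Qm /=; rewrite -addmA; apply: uQ. Qed.

Lemma adj_vars_pow K s y :
  adj (mon_ideal (k :=
    k) (vars_pow K s)) 'X_y = mon_ideal (vars_pow (y |: K) s).
Proof.
rewrite adj_mon; last exact: upset_vars_pow.
by congr mon_ideal; apply/predeqP=> m; rewrite /vars_pow meetsU1; tauto.
Qed.

Lemma adj_colon_vars_pow K s x y : x != y ->
  adj (colon (mon_ideal (k := k) (vars_pow K s)) 'X_y) 'X_x =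
  colon (mon_ideal (vars_pow (x |: K) s)) 'X_y.
Proof.
move=> xy; rewrite !colon_mon adj_mon; last by apply: upset_shift;
  apply: upset_vars_pow.
congr mon_ideal; apply/predeqP=> m;
  rewrite /vars_pow meetsU1 mnmDE mnm1E eq_sym (negPf xy).
by rewrite addn0; tauto.
Qed.

Lemma colon_vars_pow_isolated K s y : y \notin K ->
  (forall w, w \notin K -> ~~ e y w) ->
  colon (mon_ideal (k := k) (vars_pow K s)) 'X_y = mon_ideal (vars_pow K s).
Proof.
move=> yK iso; rewrite colon_mon; congr mon_ideal; apply/predeqP=> m.
split=> [|km]; last by rewrite addmC; apply: upset_vars_pow.
rewrite /vars_pow meetsD // => -[|d]; first by left.
have [mK|mK] := pselect (meets K m); [by left|right].
exact: (edge_div_isolated e_sym yK iso mK d).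
Qed.

(** For a leaf edge $xy$ of $G \setminus K$, dividing by $xy$ lowers the power by exactly one; this
    is [edge_div_leaf] at whichever endpoint is the leaf. *)
Lemma colon_vars_pow_edge K s x y : x \notin K -> y \notin K -> e x y ->
  (forall w, w \notin K -> e x w -> w = y) \/
  (forall w, w \notin K -> e y w -> w = x) ->
  colon (colon (mon_ideal (k :=
    k) (vars_pow K s.+1)) 'X_y) 'X_x = mon_ideal (vars_pow K s).
Proof.
move=> xK yK exy lf; rewrite !colon_mon; congr mon_ideal; apply/predeqP=> m.
rewrite /vars_pow !meetsD //; split=> [[|d]|[mK|d]]; try by left.
  have [mK|mK] := pselect (meets K m); [by left|right].
  case: lf => lf; first exact: (edge_div_leaf e_sym xK lf yK mK d).
  apply: (edge_div_leaf e_sym yK lf xK mK).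
  by rewrite -addmA [(U_(y) + _)%MM]addmC addmA.
by right; exists x, y, m; split=> //; rewrite -addmA addmC.
Qed.

Lemma vars_pow_edgeless K s :
  (forall a b, a \notin K -> b \notin K -> ~~ e a b) ->
  vars_pow K s.+1 = meets K.
Proof.
move=> noe; apply/predeqP=> m; split=> [[//|[a [b [m' [eab mE _]]]]]|];
  last by left.
apply: contrapT; rewrite mE => /not_meets_edge[aK bK _].
by have := noe a b aK bK; rewrite eab.
Qed.

Lemma is_ideal_vars_pow K s : is_ideal (mon_ideal (k := k) (vars_pow K s)).
Proof. exact/is_ideal_mon/upset_vars_pow. Qed.

(* C is a set of centers of pairwise disjoint stars of G \ K. *)
Definition packing K C :=
  [disjoint C & K] /\
  {in C &, forall a b v, v \notin K -> v \in closed_nbhd e a ->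
    v \in closed_nbhd e b -> a = b}.

(** The inequality is $t \leq |C| - s + 1$ without subtraction. The alternative $t \leq 1$ covers
    the bound 1 in the maximum, for which one variable outside [K] suffices. *)
Definition enough_stars K s t :=
  (0 < #|~: K|)%N /\
  ((t <= 1)%N \/ exists2 C, packing K C & (t + s <= #|C|.+1)%N).

Lemma closed_nbhdE x y : (y \in closed_nbhd e x) = (y == x) || e x y.
Proof. by rewrite !inE. Qed.

Lemma closed_nbhdC x y : (y \in closed_nbhd e x) = (x \in closed_nbhd e y).
Proof. by rewrite !closed_nbhdE eq_sym e_sym. Qed.

(** The vertex $y$ lies in the closed neighborhood of each center counted here. *)
Lemma packing_card K C y : packing K C -> y \notin K ->
  (#|C :&: closed_nbhd e y| <= 1)%N.
Proof.
move=> [_ pC] yK; apply/card_le1_eqP => a b; rewrite !in_setI.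
move=> /andP[aC ay] /andP[bC by_]; apply: (pC b a bC aC y yK).
  by rewrite closed_nbhdC.
by rewrite closed_nbhdC.
Qed.

Lemma packing_subset K K' C C' : packing K C -> K \subset K' -> C' \subset C ->
  [disjoint C' & K'] -> packing K' C'.
Proof.
move=> [_ pC] sK sC dC; split=> // a b aC bC v vK.
by apply: pC; rewrite ?(subsetP sC) //; apply: contra vK; apply/subsetP.
Qed.

Lemma card_packing_killed K K' C y : packing K C -> y \notin K ->
  K' \subset K :|: closed_nbhd e y -> (#|C| <= #|C :\: K'|.+1)%N.
Proof.
move=> pC yK sK; rewrite -(cardsID K' C) -addn1 addnC leq_add2l.
apply: leq_trans (packing_card pC yK); apply/subset_leq_card/subsetP => a.
rewrite !in_setI => /andP[aC aK']; rewrite aC /=.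
have := subsetP sK a aK'; rewrite in_setU => /orP[aK|//].
by have := disjointFr pC.1 aC; rewrite aK.
Qed.

(* An isolated vertex x of N[y] replaces the center meeting N[y]. *)
Lemma packing_swap K K' C x y : packing K C -> y \notin K ->
  K \subset K' -> K' \subset K :|: closed_nbhd e y ->
  x \in closed_nbhd e y -> x \notin K' ->
  (forall w, w \notin K' -> ~~ e x w) ->
  exists2 C', packing K' C' & (#|C| <= #|C'|)%N.
Proof.
move=> pC yK sK sK' xy xK' iso; set D := C :\: closed_nbhd e y.
have dD : [disjoint D & K'].
  rewrite disjoint_subset; apply/subsetP => a; rewrite !inE negb_or.
  case/andP=> /andP[ay eya] aC; apply/negP=> /(subsetP sK').
  rewrite !inE (negPf ay) (negPf eya) !orbF => aK.
  by have := disjointFr pC.1 aC; rewrite aK.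
have xD : x \notin D by rewrite in_setD xy.
have [_ pD] : packing K' D by apply: packing_subset pC _ _ _;
  rewrite // subsetDl.
have xonly b v : b \in D -> v \notin K' -> v \in closed_nbhd e x ->
    v \in closed_nbhd e b -> x = b.
  move=> bD vK';
    rewrite !closed_nbhdE (negPf (iso v vK')) orbF => /eqP-> /orP[/eqP//|].
  have bK' : b \notin K' by rewrite (disjointFr dD bD).
  by rewrite e_sym (negPf (iso b bK')).
exists (x |: D).
  split=> [|a b].
    by rewrite disjoints_subset subUset sub1set inE xK' -disjoints_subset.
  rewrite !in_setU1 => /predU1P[->|aD] /predU1P[->|bD] v vK va vb //.
  - exact: xonly vb.
  - by rewrite (xonly a v).
  - exact: (pD a b aD bD v).
rewrite cardsU1 xD add1n -(cardsID (closed_nbhd e y) C) -/D -add1n leq_add2r.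
exact: packing_card pC yK.
Qed.

(* The neighbors x of y are removed one at a time, z being the last one, so that
   x or y is a leaf at each step. *)
Lemma wreg_colon_vars_pow fs K s y z :
  y \notin K ->
  (forall w, w \notin K -> e y w -> w != z -> forall v, v \notin K -> e w v ->
    v = y) ->
  (forall K', K \subset K' -> K' \subset K :|: open_nbhd e y ->
     wreg (mon_ideal (k := k) (vars_pow K' s)) fs) ->
  wreg (mon_ideal (k := k) (vars_pow (K :|: open_nbhd e y) s.+1)) fs ->
  z \notin K ->
  wreg (colon (mon_ideal (k := k) (vars_pow K s.+1)) 'X_y) fs.
Proof.
move=> yK lf wlow wtop zK.
(* [K'] is [K] with the neighbors removed so far; the implication on $z$ says that $z$ goes last. *)
suff gen K' : K \subset K' -> K' \subset K :|: open_nbhd e y ->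
    (z \in K' -> open_nbhd e y \subset K') ->
    wreg (colon (mon_ideal (k := k) (vars_pow K' s.+1)) 'X_y) fs.
  by apply: gen; rewrite ?subsetUl // (negPf zK).
have [r] := ubnP #|~: K'|; elim: r K' => // r IH K' cK' sK sK' zK'.
have yK' : y \notin K'.
  by apply: contra yK => /(subsetP sK'); rewrite !inE e_irr orbF.
have out w : w \notin K' -> w \notin K by apply/contra/subsetP.
have step w : w \notin K' -> e y w -> 
    (w = z -> open_nbhd e y \subset w |: K') ->
    wreg (colon (mon_ideal (k := k) (vars_pow K' s.+1)) 'X_y) fs.
  move=> wK' eyw wz; have wy : w != y by apply: contraTneq eyw => ->;
    rewrite e_irr.
  apply: (wreg_extend (u := 'X_w)).
  - exact/is_ideal_colon/is_ideal_vars_pow.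
  - rewrite colon_vars_pow_edge //; first exact: wlow.
      by rewrite e_sym.
    (* When $w = z$, all other neighbors of $y$ are gone and $y$ is the leaf; otherwise $w$ is. *)
    have [wzE|wz'] := eqVneq w z; [right|left] => v vK' ev.
      by have := subsetP (wz wzE) v;
        rewrite !inE (negPf vK') orbF => /(_ ev)/eqP.
    by apply: (lf w) => //; apply: out.
  rewrite adj_colon_vars_pow //; apply: IH.
  - rewrite -ltnS; apply: leq_ltn_trans cK';
    rewrite (cardsD1 w (~: K')) inE wK' add1n ltnS.
    by apply: subset_leq_card; apply/subsetP=> v; rewrite !inE negb_or.
  - by apply: subset_trans sK _; apply: subsetUr.
  - apply/subsetP=> v; rewrite in_setU1 => /predU1P[->|/(subsetP sK')//].
    by rewrite !inE eyw orbT.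
  rewrite in_setU1 => /predU1P[zw|/zK' sub]; first exact/wz/esym.
  by apply: subset_trans sub _; apply: subsetUr.
have [/existsP[w /and3P[wK' eyw wz]]|/existsPn now] :=
    boolP [exists w, [&& w \notin K', e y w & w != z]].
  by apply: (step w) => // wzE; rewrite wzE eqxx in wz.
have sub : open_nbhd e y \subset z |: K'.
  apply/subsetP=> w; rewrite !inE => eyw; have := now w.
  by rewrite eyw /=; case: (w \in K'); case: eqVneq.
have [/andP[zK1 eyz]|] := boolP ((z \notin K') && e y z); first exact: (step z).
move=> nz; have sub' : open_nbhd e y \subset K'.
  apply/subsetP=> w wy; move: (subsetP sub w wy); rewrite in_setU1.
  case/predU1P=> // wz; move: nz wy; rewrite wz inE => nz eyz.
  by move: nz; rewrite eyz andbT negbK.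
(* All neighbors of $y$ are removed, so $y$ is isolated and the colon by $y$ changes nothing. *)
have -> : K' = K :|: open_nbhd e y by apply/eqP;
  rewrite eqEsubset sK' subUset sK sub'.
rewrite colon_vars_pow_isolated //.
  by rewrite !inE e_irr orbF.
by move=> w; rewrite !inE negb_or => /andP[].
Qed.

End Depth.

(** * The induction over forests *)

Section Forest.
Variables (n : nat) (k : fieldType) (e : rel 'I_n).
Hypothesis e_sym : ssrbool.symmetric e.
Hypothesis e_irr : irreflexive e.
Hypothesis e_forest : forest e.
Implicit Types (m : 'X_{1..n}) (K C : {set 'I_n}).

(** Removing neighbors of $y$ destroys at most one center, which the drop from [s.+1] to [s] pays
    for. *)
Lemma enough_stars_subset K K' s t y : enough_stars e K s.+1 t ->
  y \notin K -> y \notin K' ->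
  K \subset K' -> K' \subset K :|: open_nbhd e y -> enough_stars e K' s t.
Proof.
move=> [_ dK] yK yK' sK sK'; split; first by apply/card_gt0P; exists y;
  rewrite inE.
case: dK => [|[C pC tC]]; [by left|right].
exists (C :\: K').
  apply: (packing_subset pC sK); first exact: subsetDl.
  by rewrite disjoints_subset setDE subsetIr.
have cC : (#|C| <= #|C :\: K'|.+1)%N.
  apply: (card_packing_killed e_sym pC yK); apply: subset_trans sK' _.
  by rewrite setUS // subsetUr.
by apply: leq_trans cC; rewrite -ltnS -addnS.
Qed.

Lemma enough_stars_swap K K' s t x y : enough_stars e K s t -> y \notin K ->
  K \subset K' -> K' \subset K :|: closed_nbhd e y ->
  x \in closed_nbhd e y -> x \notin K' ->
  (forall w, w \notin K' -> ~~ e x w) -> enough_stars e K' s t.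
Proof.
move=> [_ dK] yK sK sK' xy xK' iso.
split; first by apply/card_gt0P; exists x; rewrite inE.
case: dK => [|[C pC tC]]; [by left|right].
have [C' pC' cC'] := packing_swap e_sym pC yK sK sK' xy xK' iso.
by exists C' => //; apply: leq_trans tC _.
Qed.

Lemma card_setC_lt K K' x : K \subset K' -> x \notin K -> x \in K' ->
  (#|~: K'| < #|~: K|)%N.
Proof.
move=> sK xK xK'; apply: proper_card; rewrite properC properE sK.
by apply/subsetPn; exists x.
Qed.

(** Induction on [s + #|~: K|]: each ideal reached from $y$ has a smaller power or more variables
    killed. *)
Lemma wreg_vars_pow K s t : enough_stars e K s t ->
  wreg (mon_ideal (k := k) (vars_pow e K s)) (esyms n k t).
Proof.
have [N] := ubnP (s + #|~: K|); elim: N K s => // N IH K [|s] leN dK.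
  (* The zeroth power is the unit ideal, on which weak regularity is vacuous. *)
  by apply: wreg_full => f m _; right.
have [/existsP[a /existsP[b eab]]|/existsPn noe] :=
    boolP [exists a, exists b, [&& a \notin K, b \notin K & e a b]]; last first.
  rewrite vars_pow_edgeless => [|a b aK bK]; last first.
    by have := existsPn (noe a) b; rewrite aK bK.
  apply: wreg_esyms_vars; case: dK => Kgt [tle|[C [dC _] tC]].
    exact: leq_trans tle Kgt.
  rewrite disjoints_subset in dC; apply: leq_trans (subset_leq_card dC).
  by move: tC; rewrite addnS ltnS; apply: leq_trans; apply: leq_addr.
(* The forest induced on the complement of [K]. *)
pose f := [rel u v | [&& u \notin K, v \notin K & e u v]].
have [||c cgt cu|x [y [z [fyx fyz xleaf leaves]]]] :=
  @forest_end _ f a b _ _ _ eab.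
- by move=> u v; rewrite /= e_sym; case: (u \in K); case: (v \in K).
- by move=> u; rewrite /= e_irr !andbF.
- apply: contra (e_forest cgt cu); apply: sub_cycle => u v /=.
  by case/and3P.
move: fyx fyz => /and3P[yK xK eyx] /and3P[_ zK eyz].
have xy : x != y by apply: contraTneq eyx => ->; rewrite e_irr.
apply: (wreg_extend (u := 'X_y)); first exact: is_ideal_vars_pow.
  apply: (@wreg_colon_vars_pow _ _ _ e_sym e_irr _ _ _ _ z yK) => //.
  - by move=> w wK eyw wz v vK ewv; apply: (leaves w); rewrite //= ?yK ?wK ?vK.
  - move=> K' sK sK'; have yK' : y \notin K'.
      by apply: contra yK => /(subsetP sK'); rewrite !inE e_irr orbF.
    apply: IH; last exact: enough_stars_subset dK yK yK' sK sK'.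
    rewrite -ltnS; apply: leq_trans leN; rewrite addSn !ltnS leq_add2l.
    by apply: subset_leq_card; rewrite setCS.
  apply: IH.
    rewrite -ltnS; apply: leq_trans leN; rewrite ltnS -addnS leq_add2l.
    apply: (@card_setC_lt _ _ x) => //; first exact: subsetUl.
    by rewrite !inE eyx orbT.
  (* With its neighbors killed, $y$ is isolated and replaces the lost center; in the branch that
     kills $y$, the leaf $x$ does so. *)
  apply: (enough_stars_swap (x := y) dK yK).
  - exact: subsetUl.
  - by rewrite setUS // subsetUr.
  - by rewrite !inE eqxx.
  - by rewrite !inE e_irr orbF.
  - by move=> w; rewrite !inE negb_or => /andP[].
rewrite adj_vars_pow; apply: IH.
  rewrite -ltnS; apply: leq_trans leN; rewrite ltnS -addnS leq_add2l.
  by apply: (@card_setC_lt _ _ y); rewrite ?subsetUr // !inE eqxx.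
apply: (enough_stars_swap (x := x) dK yK).
- exact: subsetUr.
- by rewrite setUC setUS // sub1set !inE eqxx.
- by rewrite !inE eyx orbT.
- by rewrite !inE negb_or xy.
- move=> w; rewrite !inE negb_or => /andP[wy wK]; apply: contra wy => exw.
  by apply/eqP/xleaf; rewrite /= xK wK.
Qed.

(** A monomial in the support of a product is a product of monomials from the factors, each
    divisible by an edge; conversely, the edges split off a monomial supply the factors. *)
Lemma ideal_pow_edgeE s :
  ideal_pow (edge_ideal k e) s = mon_ideal (vars_pow e set0 s).
Proof.
apply/predeqP=> f; split.
  apply: ideal_gen_min; first exact: is_ideal_vars_pow.
  move=> {}f [g Ig ->] m fm; right; move: m fm.
  elim: s g Ig => // s IH g Ig m; rewrite big_ord_recl -mcoeff_msupp.
  case/msuppM_le/allpairsP=> -[m1 m2] [/= gm1 pm2 ->].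
  have [a [b [m' [eab m1E]]]] :
    exists a b m', e a b /\ m1 = (U_(a) + U_(b) + m')%MM.
    have : mon_ideal (fun m =>
      exists a b m', e a b /\ m = (U_(a) + U_(b) + m')%MM) (g ord0).
      apply: ideal_gen_min (Ig ord0).
        apply: is_ideal_mon => m3 m4 [a [b [m' [eab ->]]]];
          exists a, b, (m4 + m')%MM.
        by split=> //; rewrite addmC -!addmA [(m' + _)%MM]addmC.
      move=> _ [a [b [eab ->]]]; rewrite -mpolyXD; apply/mon_idealX.
      by exists a, b, 0%MM; rewrite addm0.
    by apply; rewrite -mcoeff_msupp.
  apply: (edge_div_edge eab (m' := (m' + m2)%MM)); first by rewrite m1E -!addmA.
  apply: upset_edge_div; apply: (IH (g \o lift ord0)) => [i|]; first exact: Ig.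
  by rewrite -mcoeff_msupp.
apply: mon_ideal_min; first exact: is_ideal_gen.
move=> m [[i]|]; first by rewrite inE.
move=> d; suff [g [Ig [m' ->]]] : exists g : 'I_s -> {mpoly k[n]},
    (forall i, edge_ideal k e (g i)) /\
    exists m', 'X_[m] = 'X_[m'] * \prod_(i < s) g i.
  apply: idealMl; first exact: is_ideal_gen.
  by apply: mem_ideal_gen; exists g.
elim: s m d => [|s IH] m /=.
  by move=> _; exists (fun=> 0); split=> [[]|] //; exists m;
    rewrite big_ord0 mulr1.
move=> [a [b [m1 [eab -> /IH[g [Ig [m' gE]]]]]]].
exists (fun i => if unlift ord0 i is Some j then g j else 'X_a * 'X_b).
split=> [i|].
  case: unliftP => [j _|_]; first exact: Ig.
  by apply: mem_ideal_gen; exists a, b.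
exists m'; rewrite big_ord_recl unlift_none.
under eq_bigr => i _ do rewrite liftK.
by rewrite mpolyXD gE mpolyXD mulrCA.
Qed.

End Forest.

(** * From star packings to centers, and the depth bound *)

Lemma star_packing_centers (V : finType) (e : rel V) :
  exists2 C : {set V}, {in C &, forall a b v, v \in closed_nbhd e a ->
    v \in closed_nbhd e b -> a = b} & (star_packing_number e <= #|C|)%N.
Proof.
rewrite /star_packing_number.
elim/big_ind:
  _ => [|x y [C pC xC] [C' pC' yC']|S /and3P[/subsetP stS /trivIsetP tS _]].
- by exists set0 => // a b; rewrite inE.
- by case: (leqP x y) => _; [exists C'|exists C].
have [->|/set0Pn[A0 /stS/imsetP[b0 _ _]]] := eqVneq S set0.
  by exists set0 => [a b|]; rewrite ?inE ?cards0.
pose c A := odflt b0 [pick b | closed_nbhd e b == A].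
have cK A : A \in S -> closed_nbhd e (c A) = A.
  move=> /stS/imsetP[b _ ->]; rewrite /c.
  by case: pickP => [b' /eqP//|/(_ b)]; rewrite eqxx.
exists (c @: S).
  move=> _ _ /imsetP[A AS ->] /imsetP[B BS ->] v; rewrite !cK // => vA vB.
  have [->//|AB] := eqVneq A B.
  by have := disjointFr (tS A B AS BS AB) vA; rewrite vB.
by rewrite card_in_imset // => A B AS BS cAB; rewrite -(cK A) // cAB cK.
Qed.

Lemma irrelevant_esyms n (k : fieldType) t f : f \in esyms n k t ->
  irrelevant_ideal k n f.
Proof.
case/mapP=> i _ ->; rewrite /mesym.
apply: (ideal_sum (is_ideal_gen _)) => h _ /eqP hi.
have /card_gt0P[j jh] : (0 < #|h|)%N by rewrite hi.
rewrite (bigD1 j) //= mulrC; apply: (idealMl _ (is_ideal_gen _)).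
by apply: mem_ideal_gen; exists j.
Qed.

Lemma irrelevant_proper n (k : fieldType) : ~ irrelevant_ideal k n 1.
Proof.
move=> I1; have : mon_ideal (fun m : 'X_{1..n} => m != 0%MM) (1 : {mpoly k[n]}).
  apply: ideal_gen_min I1.
    apply: is_ideal_mon => m m' m0; rewrite -mdeg_eq0 mdegD addn_eq0 negb_and.
    by rewrite !mdeg_eq0 m0 orbT.
  by move=> _ [i ->]; apply/mon_idealX; rewrite mnm1_eq0.
by move/(_ 0%MM); rewrite mcoeff1 eqxx oner_eq0 => /(_ isT).
Qed.

(** If no maximal length exists, the depth is [+oo] and the bound is trivial. *)
Lemma depth_quotient_ge (R : comNzRingType) (m J : R -> Prop) d :
  has_regular_seq m J d -> (d%:Z%:E <= depth_quotient m J)%E.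
Proof.
move=> rd; rewrite /depth_quotient; case: pselect => [h|_]; last exact: leey.
by case: (cid h) => d' [_ d'max] /=; rewrite lee_fin lez_nat; apply: d'max.
Qed.

Theorem theorem3p7 (k : fieldType) (n : nat) (e : rel 'I_n)
    (e_simple : simple_graph e) (e_forest : forest e)
    (e_edge : exists x y : 'I_n, e x y)
    (s : nat) (s_ge1 : (1 <= s)%N) :
  ((Num.max ((star_packing_number e)%:Z - s%:Z + 1) 1)%:E
     <= depth_quotient (irrelevant_ideal k n)
          (ideal_pow (edge_ideal k e) s))%E.
Proof.
case: e_simple => e_sym e_irr.
(* Truncated subtraction is harmless here: where it cuts off, the maximum is 1 anyway. *)
set al := star_packing_number e; pose t := maxn (al.+1 - s) 1.
have -> : Num.max (al%:Z - s%:Z + 1) 1 = t%:Z by rewrite /t; lia.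
apply: depth_quotient_ge; rewrite ideal_pow_edgeE //.
have iI := is_ideal_vars_pow k e set0 s.
have w : wreg (mon_ideal (vars_pow e set0 s)) (esyms n k t).
  apply: wreg_vars_pow => //; have [x _] := e_edge.
  split; first by rewrite setC0; apply/card_gt0P; exists x; rewrite inE.
  have [C pC cC] := star_packing_centers e.
  case: (leqP t 1) => [|t1]; [by left|right]; exists C; last first.
    by move: t1 cC; rewrite /t -/al; move: (al) #|C| => a c; lia.
  split; first by rewrite disjoint_sym disjoints_subset sub0set.
  by move=> a b aC bC v _; apply: pC.
exists (esyms n k t); split.
- by rewrite size_map size_iota.
- exact: irrelevant_esyms.
split=> [i it g|].
  by rewrite ideal_adjoinE //; apply: wreg_nzd.
(* Properness: $I^s$, which has a factor to split off as $s \geq 1$, and the symmetric polynomials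
   all lie in the irrelevant ideal. *)
rewrite ideal_adjoinE // => J1; apply: (@irrelevant_proper n k).
apply: foldl_adj_min J1; first exact: is_ideal_gen.
  move=> f; rewrite -ideal_pow_edgeE //; apply: ideal_gen_min.
    exact: is_ideal_gen.
  move=> _ [g Ig ->]; case: s s_ge1 g Ig {iI w t} => // s _ g Ig.
  rewrite big_ord_recl mulrC; apply: (idealMl _ (is_ideal_gen _)).
  apply: ideal_gen_min (Ig ord0); first exact: is_ideal_gen.
  move=> _ [a [b [_ ->]]]; apply: (idealMl _ (is_ideal_gen _)).
  by apply: mem_ideal_gen; exists b.
exact: irrelevant_esyms.
Qed.
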